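(* Let $X$ be a finite-dimensional real Banach space. Suppose that there is a $\delta\in(0,1/2)$ such that $\Phi_X(\delta)=\sqrt{2\delta}$ (or, equivalently, $\Phi_X^S(\delta)=\sqrt{2\delta}$). Then $X^*$ contains an isometric copy of the real space $\ell_\infty^{(2)}$ (hence, $X$ also contains an isometric copy of $\ell_\infty^{(2)}$).
   Context: For a (real or complex) Banach space $X\neq\{0\}$, $B_X$ and $S_X$ denote its closed unit ball and unit sphere, $X^*$ its topological dual, and $\Pi(X):=\{(x,x^* )\in X\times X^* : \|x\|=\|x^*\|=x^*(x)=1\}$. The Bishop-Phelps-Bollobás modulus $\Phi_X:(0,2)\to[0,\infty)$ is defined as follows: $\Phi_X(\delta)$ is the infimum of those $\varepsilon>0$ such that for every $(x,x^* )\in B_X\times B_{X^*}$ with $\operatorname{Re} x^*(x)>1-\delta$ there is $(y,y^* )\in\Pi(X)$ with $\|x-y\|<\varepsilon$ and $\|x^*-y^*\|<\varepsilon$. The spherical Bishop-Phelps-Bollobás modulus $\Phi_X^S:(0,2)\to[0,\infty)$ is defined in the same way with $B_X\times B_{X^*}$ replaced by $S_X\times S_{X^*}$. The real space $\ell_\infty^{(2)}$ is $\mathbb{R}^2$ with the maximum norm; a space contains an isometric copy of it if it has a subspace linearly isometric to it. *)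

(* Defs.v *)
From HB Require Import structures.
From mathcomp Require Import all_boot all_order all_algebra.
From mathcomp Require Import all_classical all_reals all_analysis.

Set Implicit Arguments.
Unset Strict Implicit.
Unset Printing Implicit Defensive.

Import Order.TTheory GRing.Theory Num.Theory.
Import numFieldNormedType.Exports.

Local Open Scope classical_set_scope.
Local Open Scope ring_scope.

#[short(type="finDimBanachType")]
HB.structure Definition FinDimBanach (R : realType) :=
  {T of CompleteNormedModule R T & Vector R T}.

Section dual.
Context {R : realType} (X : normedModType R).

Definition dual_pred : {pred X -> R^o} :=
  [pred f | `[< linear f /\ continuous f >]].

Record dual := Dual { dual_fun :> X -> R^o ; _ : dual_fun \in dual_pred }.

HB.instance Definition _ := [isSub for dual_fun].
HB.instance Definition _ := [Choice of dual by <:].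

Lemma dual_pred_submod : submod_closed dual_pred.
Proof.
split.
  apply/asboolP; split; last by move=> x; exact: cvg_cst.
  by move=> a x y /=; rewrite [RHS]addr0 [RHS]scaler0.
move=> a f g /asboolP[lf cf] /asboolP[lg cg]; apply/asboolP; split.
  move=> b x y /=.
  have E (r s t u : R) :
      a * (b * r + s) + (b * t + u) = b * (a * r + t) + (a * s + u).
    by rewrite !mulrDr !mulrA (mulrC a b) addrACA.
  by rewrite [LHS]/(a * f (b *: x + y) + g (b *: x + y) : R) lf lg; exact: E.
by move=> x; apply: cvgD; [apply: cvgZr; exact: cf|exact: cg].
Qed.

HB.instance Definition _ :=
  GRing.isSubmodClosed.Build _ _ dual_pred dual_pred_submod.
HB.instance Definition _ := [SubChoice_isSubLmodule of dual by <:].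

Implicit Types f g : dual.

Lemma dual_linear f : linear f.
Proof. by case: f => f /= /asboolP[]. Qed.

Lemma dual_continuous f : continuous f.
Proof. by case: f => f /= /asboolP[]. Qed.

HB.instance Definition _ f :=
  GRing.isLinear.Build R X R^o *:%R f (dual_linear f).

Lemma dualDE f g x : (f + g) x = f x + g x. Proof. by []. Qed.

Lemma dualZE a f x : (a *: f) x = a * f x. Proof. by []. Qed.

Definition dual_values f : set R := [set `|f x| | x in [set x : X | `|x| <= 1]].

Definition dual_norm f : R := sup (dual_values f).

Lemma has_sup_dual_values f : has_sup (dual_values f).
Proof.
split; first by exists `|f 0|, 0 => //=; rewrite normr0.
have /linear_boundedP/pinfty_ex_gt0[r r0 fr] :=
  continuous_linear_bounded 0 (@dual_continuous f 0).
exists r => _ [x /= x1 <-].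
by apply: (le_trans (fr x)); rewrite ler_piMr// ltW.
Qed.

Lemma dual_norm_ub f x : `|x| <= 1 -> `|f x| <= dual_norm f.
Proof.
by move=> x1; apply: sup_upper_bound; [exact: has_sup_dual_values|exists x].
Qed.

Lemma dual_norm_le f (M : R) :
  (forall x, `|x| <= 1 -> `|f x| <= M) -> dual_norm f <= M.
Proof.
move=> fM; apply: ge_sup; first by case: (has_sup_dual_values f).
by move=> _ [x /= /fM ? <-].
Qed.

Lemma dual_norm_ge0 f : 0 <= dual_norm f.
Proof.
by apply: (le_trans (normr_ge0 (f 0))); apply: dual_norm_ub; rewrite normr0.
Qed.

Lemma ler_dual_normD f g : dual_norm (f + g) <= dual_norm f + dual_norm g.
Proof.
apply: dual_norm_le => x x1; rewrite dualDE (le_trans (ler_normD _ _))//.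
by rewrite lerD// dual_norm_ub.
Qed.

Lemma ler_dual_normZ a f : dual_norm (a *: f) <= `|a| * dual_norm f.
Proof.
apply: dual_norm_le => x x1.
by rewrite dualZE normrM ler_wpM2l// dual_norm_ub.
Qed.

Lemma dual_normZ a f : dual_norm (a *: f) = `|a| * dual_norm f.
Proof.
apply/eqP; rewrite eq_le ler_dual_normZ/=.
have [->|a0] := eqVneq a 0; first by rewrite normr0 mul0r dual_norm_ge0.
rewrite mulrC -ler_pdivlMr ?normr_gt0// mulrC -normfV.
by apply: le_trans (ler_dual_normZ _ _); rewrite scalerA mulVf// scale1r.
Qed.

Lemma dual_norm_eq0 f : dual_norm f = 0 -> f = 0.
Proof.
move=> f0; apply/val_inj/funext => x /=; rewrite [RHS]/(0 : R).
have [->|x0] := eqVneq x 0; first by rewrite linear0.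
have : `|f (`|x|^-1 *: x)| <= 0 by rewrite -f0 dual_norm_ub// normfZV.
rewrite normr_le0 linearZ/= mulf_eq0 invr_eq0 normr_eq0 (negbTE x0)/=.
by move/eqP.
Qed.

HB.instance Definition _ :=
  Lmodule_isNormed.Build R dual ler_dual_normD dual_normZ dual_norm_eq0.

Lemma dual_normE f : `|f| = sup [set `|f x| | x in [set x : X | `|x| <= 1]].
Proof. by []. Qed.

End dual.

Section bishop_phelps_bollobas.
Context {R : realType} (X : normedModType R).

Definition norming_pairs : set (X * dual X) :=
  [set p : X * dual X | [/\ `|p.1| = 1, `|p.2| = 1 & p.2 p.1 = 1]].

Definition ball_pairs : set (X * dual X) :=
  [set p : X * dual X | `|p.1| <= 1 /\ `|p.2| <= 1].

Definition sphere_pairs : set (X * dual X) :=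
  [set p : X * dual X | `|p.1| = 1 /\ `|p.2| = 1].

Definition BPB_admissible (D : set (X * dual X)) (delta : R) : set R :=
  [set eps | 0 < eps /\
     forall p, D p -> 1 - delta < p.2 p.1 ->
       exists2 q, norming_pairs q &
         `|p.1 - q.1| < eps /\ `|p.2 - q.2| < eps].

(* For X != 0 and 0 < delta < 2 the set is nonempty (it contains every
   eps > 2), so that the real-valued infimum is the intended one.  *)
Definition BPB_modulus (delta : R) : R := inf (BPB_admissible ball_pairs delta).

Definition spherical_BPB_modulus (delta : R) : R :=
  inf (BPB_admissible sphere_pairs delta).

End bishop_phelps_bollobas.

Definition contains_isometric_copy {R : realType} (X Y : normedModType R) :=
  exists T : {linear Y -> X}, forall y, `|T y| = `|y|.

(* The library norm on matrices is the maximum of the absolute values of the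
   entries. *)
Definition linfty2 (R : realType) : normedModType R := 'rV[R]_2.

Lemma linfty2_normE (R : realType) (v : 'rV[R]_2) :
  `|v : linfty2 R| = Num.max `|v 0 0| `|v 0 1|.
Proof.
rewrite [LHS]/Num.norm/= mx_normrE; apply/eqP; rewrite eq_le ge_max.
apply/andP; split; last first.
  by apply/andP; split; [apply: (le_bigmax _ _ (0, 0))|apply: (le_bigmax _ _ (0, 1))].
apply/bigmax_leP; split=> [|[i j] _ /=]; first by rewrite le_max normr_ge0.
rewrite ord1 le_max; case: j => -[|[|//]] j2; apply/orP; [left|right].
  by rewrite (_ : Ordinal j2 = 0)//; exact: val_inj.
by rewrite (_ : Ordinal j2 = 1)//; exact: val_inj.
Qed.

(* Main.v *)
From HB Require Import structures.
Require Import Defs.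
From mathcomp Require Import all_boot all_order all_algebra.
From mathcomp Require Import all_classical all_reals all_analysis.
From mathcomp Require Import ring lra.

Set Implicit Arguments.
Unset Strict Implicit.
Unset Printing Implicit Defensive.

Import Order.TTheory GRing.Theory Num.Theory.
Import numFieldNormedType.Exports.

Local Open Scope classical_set_scope.
Local Open Scope ring_scope.

(* Write w = sqrt (2 delta).  Given x in the ball, f of norm 1 and k in (0, 1),
   let y maximize f z - k |z - x| on the ball; separating the tangent cone of
   the ball at y yields a norming pair (y, g) with k |x - y| <= f y - f x and
   f = k h + t g, where |h| <= 1 and |1 - t| <= k.  For sphere pairs, k = w / 2
   gives distances at most w; for delta < 1/2 a ball pair that is bounded away
   from the spheres can first be normalized with a definite gain, whence the
   equivalence of the two equalities.

   If the spherical modulus equals w, take sphere pairs that are not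
   approximable within e, with e close to w, and k = delta / e.  Then
   |x - y| < e, so |f - g| = |k h + (t - 1) g| >= e, where e is nearly 2 k.
   This forces t to be nearly 1 - k and |h - g| nearly 2, while
   |k h + t g| = 1 forces |h + g| to be nearly 2.  Points of the ball
   at which h - g and f nearly attain these norms are almost vertices of a
   square, and compactness gives u, v in the ball with |u + v| = |u - v| = 2.
   They span a copy of l_1^2, isometric to l_infty^2; so do, in the dual, the
   norming functionals of u + v and u - v. *)

(** * Sublinear functionals and constraints on a convex cone *)

Section sublinear.
Context {R : realType} {X : lmodType R}.

Definition sublinear (p : X -> R) :=
  (forall u v, p (u + v) <= p u + p v) /\
  (forall (a : R) v, 0 <= a -> p (a *: v) = a * p v).

(** A pair [(x, a)] in such a cone encodes the requirement [a <= f x] on a functional [f] to be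
    constructed. *)
Definition convex_cone (C : set (X * R)) :=
  [/\ C (0, 0),
      forall c d, C c -> C d -> C (c.1 + d.1, c.2 + d.2) &
      forall (a : R) c, 0 < a -> C c -> C (a *: c.1, a * c.2)].

Lemma convex_cone_ray (x : X) (a : R) :
  convex_cone [set c | exists2 t : R, 0 <= t & c = (t *: x, t * a)].
Proof.
split.
- by exists 0; rewrite // scale0r mul0r.
- move=> _ _ [t t0 ->] [u u0 ->]; exists (t + u); first exact: addr_ge0.
  by rewrite scalerDl mulrDl.
- move=> b _ b0 [t t0 ->]; exists (b * t); first by rewrite mulr_ge0// ltW.
  by rewrite scalerA mulrA.
Qed.

Lemma sublinear0 p : sublinear p -> p 0 = 0.
Proof. by case=> _ /(_ 0 0 (lexx _)); rewrite scale0r mul0r. Qed.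

Lemma sublinear_oppr p : sublinear p -> forall v, - p (- v) <= p v.
Proof.
by move=> sp v; have := sp.1 v (- v); rewrite subrr sublinear0// => ?; lra.
Qed.

(* Applied to the ray through (e, p e), this makes the new functional odd at e;
   in finite dimension, finitely many such steps replace Zorn's lemma in the
   Hahn-Banach theorem. *)
Lemma sublinear_cone p (C : set (X * R)) : sublinear p -> convex_cone C ->
  (forall c, C c -> c.2 <= p c.1) ->
  exists q, [/\ sublinear q, forall v, q v <= p v &
                forall c, C c -> q (- c.1) <= - c.2].
Proof.
move=> sp [C0 CD CZ] Cp.
(* A linear [f <= p] with [c.2 <= f c.1] on [C] satisfies [f v <= p (v + c.1) - c.2]; the infimum of
   these bounds is the new functional. *)
pose S v : set R := [set p (v + c.1) - c.2 | c in C].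
have Slb v : lbound (S v) (- p (- v)).
  move=> _ [c Cc <-]; have := Cp _ Cc; have := sp.1 (v + c.1) (- v).
  by rewrite addrAC subrr add0r => ? ?; lra.
have hlb v : has_lbound (S v) by exists (- p (- v)).
have S0 v : S v !=set0 by exists (p (v + 0) - 0), (0, 0).
pose q v := inf (S v).
have qle v c : C c -> q v <= p (v + c.1) - c.2.
  by move=> Cc; apply: ge_inf => //; exists c.
have qp v : q v <= p v by have := qle v _ C0; rewrite /= addr0 subr0.
have qZ a v : 0 < a -> q (a *: v) <= a * q v.
  move=> a0; rewrite -ler_pdivrMl//; apply: lb_le_inf => // _ [c Cc <-].
  rewrite ler_pdivrMl// mulrBr -sp.2 ?(ltW a0)// scalerDr.
  exact: (qle _ _ (CZ _ _ a0 Cc)).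
have q0 : q 0 = 0.
  apply/eqP; rewrite eq_le; apply/andP; split.
    by rewrite (le_trans (qp 0))// sublinear0.
  apply: lb_le_inf => // r /Slb; rewrite oppr0 (sublinear0 sp) oppr0; exact.
exists q; split=> //.
- split=> [u v|a v].
    rewrite -lerBlDr; apply: lb_le_inf => // _ [c Cc <-].
    rewrite lerBlDr -lerBlDl; apply: lb_le_inf => // _ [d Cd <-].
    have := qle (u + v) _ (CD _ _ Cc Cd).
    have := sp.1 (u + c.1) (v + d.1).
    by rewrite addrACA /= => ? ?; lra.
  rewrite le_eqVlt => /predU1P[<-|a0]; first by rewrite scale0r mul0r q0.
  apply/eqP; rewrite eq_le qZ//= -ler_pdivlMl//.
  have := qZ a^-1 (a *: v); rewrite invr_gt0 => /(_ a0).
  by rewrite scalerA mulVf ?scale1r// gt_eqF.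
- by move=> c Cc; have := qle (- c.1) _ Cc; rewrite addNr (sublinear0 sp) sub0r.
Qed.

Lemma sublinear_odd_seq p (s : seq X) : sublinear p ->
  exists q, [/\ sublinear q, forall v, q v <= p v &
                forall e, e \in s -> q (- e) <= - q e].
Proof.
move=> sp; elim: s => [|e s [q [sq qp qs]]]; first by exists p.
pose C : set (X * R) := [set c | exists2 t, 0 <= t & c = (t *: e, t * q e)].
have CC : convex_cone C by exact: convex_cone_ray.
have Cq c : C c -> c.2 <= q c.1 by move=> [t t0 ->] /=; rewrite sq.2.
have [q' [sq' q'q Cq']] := sublinear_cone sq CC Cq.
exists q'; split=> // [v|]; first exact: le_trans (q'q v) (qp v).
move=> x; rewrite inE => /predU1P[->|xs].
  have Ce : C (e, q e) by exists 1; rewrite ?scale1r ?mul1r.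
  by apply: le_trans (Cq' _ Ce) _; rewrite lerN2.
(* Oddness at earlier vectors survives the decrease: [q' (- x) <= q (- x) <= - q x <= - q' x]. *)
have := q'q (- x); have := q'q x; have := qs x xs; lra.
Qed.

End sublinear.

(** * The Hahn-Banach theorem in finite dimension *)

Section hahn_banach.
Import VectorInternalTheory.
Context {R : realType} {X : vectType R}.

(** Lower [p] once for [C], then once for each basis vector. A sublinear functional that is odd on a
    basis is odd everywhere, hence linear, and oddness turns [q (- c.1) <= - c.2] into the required
    lower bound. *)
Lemma hahn_banach (p : X -> R) (C : set (X * R)) : sublinear p ->
  convex_cone C -> (forall c, C c -> c.2 <= p c.1) ->
  exists f : {linear X -> R^o}, (forall v, f v <= p v) /\
    (forall c, C c -> c.2 <= f c.1).
Proof.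
move=> sp CC Cp; have [p' [sp' p'p p'C]] := sublinear_cone sp CC Cp.
pose s := [seq r2v (delta_mx 0 i) | i : 'I_(dim X)].
have [q [sq qp' qs]] := sublinear_odd_seq s sp'.
have qN v : q (- v) = - q v.
  suff {v} E v : q (- v) <= - q v.
    apply/eqP; rewrite eq_le E/=; have := sublinear_oppr sq v => ?; lra.
  rewrite -[v]v2rK [v2r v]row_sum_delta linear_sum/=.
  elim/big_ind: _ => [|u w Eu Ew|i _].
  - by rewrite oppr0 (sublinear0 sq) oppr0.
  - by rewrite opprD; have := sq.1 u w; have := sq.1 (- u) (- w) => ? ?; lra.
  - rewrite linearZ/=; set e := r2v _; set a := v2r v 0 i.
    have Ee : q (- e) <= - q e.
      by apply: qs; apply/mapP; exists i; rewrite ?mem_enum.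
    have Ee' := sublinear_oppr sq e.
    have [a0|a0] := leP 0 a.
      by rewrite -scalerN !sq.2// -mulrN ler_wpM2l.
    have [b b0 ->] : exists2 b, 0 <= b & a = - b by exists (- a); lra.
    rewrite scaleNr opprK -scalerN !sq.2// -mulrN ler_wpM2l//; lra.
have qD u v : q (u + v) = q u + q v.
  apply/eqP; rewrite eq_le sq.1/=.
  by have := sq.1 (u + v) (- v); rewrite addrK qN => ?; lra.
have qZ (a : R) v : q (a *: v) = a * q v.
  have [a0|a0] := leP 0 a; first by rewrite sq.2.
  have [b b0 ->] : exists2 b, 0 <= b & a = - b by exists (- a); lra.
  by rewrite scaleNr qN sq.2// mulNr.
have ql : linear (q : X -> R^o) by move=> a u v; rewrite qD qZ.
pose f : {linear X -> R^o} :=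
  HB.pack q (GRing.isLinear.Build R X R^o *:%R q ql).
exists f; split=> [v|c Cc]; first exact: le_trans (qp' v) (p'p v).
by rewrite -lerN2 -[- f _]/(- q _) -qN (le_trans (qp' _))// p'C.
Qed.

End hahn_banach.

(** * Compactness of the closed unit ball *)

Section compactness.
Import VectorInternalTheory.
Context {R : realType} (X : finDimBanachType R).

Lemma r2v_continuous : continuous (r2v : 'rV[R]_(dim X) -> X).
Proof.
apply: (bounded_linear_continuous (f := (r2v : {linear 'rV[R]_(dim X) -> X}))).
apply/linear_boundedP.
pose M := \sum_i `|r2v (delta_mx 0 i) : X|.
near=> r => v /=; rewrite {1}[v]row_sum_delta linear_sum/=.
apply: (le_trans (ler_norm_sum _ _ _)).
apply: (@le_trans _ _ (M * `|v|)); last first.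
  by rewrite ler_wpM2r//; near: r; exact: nbhs_pinfty_ge.
rewrite mulr_suml ler_sum// => i _; rewrite linearZ normrZ/= mulrC ler_wpM2l//.
rewrite [leRHS]/Num.norm/= mx_normrE; exact: (le_bigmax _ _ (0, i)).
Unshelve. all: by end_near. Qed.

(** The norm of [X], read in coordinates, has a positive minimum [m] on the compact coordinate
    sphere. Hence the ball is the continuous image of a closed bounded set of coordinates. *)
Lemma compact_closed_ball : compact [set x : X | `|x| <= 1].
Proof.
pose N (v : 'rV[R]_(dim X)) := `|r2v v : X|.
have cN : continuous N.
  move=> v; apply: (continuous_comp (@r2v_continuous v)).
  exact: norm_continuous.
have [m m0 mN] : exists2 m : R, 0 < m & forall v, m * `|v| <= N v.
  have [S0|S0] := pselect ([set v : 'rV[R]_(dim X) | `|v| = 1] !=set0).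
    have Sc : compact [set v : 'rV[R]_(dim X) | `|v| = 1].
      apply: bounded_closed_compact.
        by exists 1; split=> // M M1 x /= ->; exact: ltW.
      apply: (preimage_closed (f := fun v : 'rV[R]_(dim X) => `|v|) (D := [set 1])).
        by move=> v _; exact: norm_continuous.
      exact: closed_eq.
    have [c] := compact_EVT_min S0 Sc (continuous_subspaceT cN).
    rewrite inE/= => c1 cm; exists (N c).
      rewrite normr_gt0; apply/negP => /eqP c0.
      have : c = 0 by apply: r2v_inj; rewrite c0 linear0.
      by move=> cE; move: c1; rewrite cE normr0 => /esym/eqP; rewrite oner_eq0.
    move=> v; have [->|v0] := eqVneq v 0.
      by rewrite normr0 mulr0 normr_ge0.
    have := cm (`|v|^-1 *: v); rewrite inE/= normfZV// => /(_ erefl).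
    rewrite {2}/N linearZ normrZ/= normfV normr_id.
    by rewrite ler_pdivlMl ?normr_gt0// mulrC.
  (* An empty coordinate sphere means dimension zero, where any positive [m] works. *)
  exists 1 => // v; have [->|v0] := eqVneq v 0.
    by rewrite normr0 mulr0 normr_ge0.
  by exfalso; apply: S0; exists (`|v|^-1 *: v); rewrite /= normfZV.
have -> : [set x : X | `|x| <= 1] = r2v @` [set v | N v <= 1].
  apply/seteqP; split=> [x /= x1|_ [v /= v1 <-]//].
  by exists (v2r x); rewrite /= /N v2rK.
apply: continuous_compact; first exact/continuous_subspaceT/r2v_continuous.
apply: bounded_closed_compact.
  exists m^-1; split=> [|M mM v]; first exact: num_real.
  move: mM => /= mM; move: v => v /= v1; apply/ltW/le_lt_trans/mM.
  by rewrite -[leRHS]mulr1 ler_pdivlMl// (le_trans (mN v)).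
apply: (preimage_closed (f := N) (D := [set r | r <= 1])).
  by move=> v _; exact: cN.
exact: closed_le.
Qed.

End compactness.

(** * Evaluation and norm bounds for functionals *)

Section dual_theory.
Context {R : realType} {X : normedModType R}.
Implicit Types (f g : dual X) (v : X).

(* The casts select the operations of R rather than those of R^o. *)
Lemma dualBE f g v : (f - g) v = f v - g v :> R.
Proof. by []. Qed.

Lemma dual_linN f v : f (- v) = - f v :> R.
Proof. exact: linearN. Qed.

Lemma dual_linD f u v : f (u + v) = f u + f v :> R.
Proof. exact: linearD. Qed.

Lemma dual_linB f u v : f (u - v) = f u - f v :> R.
Proof. exact: linearB. Qed.

Lemma dual_linZ f a v : f (a *: v) = a * f v :> R.
Proof. exact: linearZ. Qed.

Lemma dual_ler_norm f v : `|f v| <= `|f| * `|v|.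
Proof.
have [->|v0] := eqVneq v 0; first by rewrite linear0 !normr0 mulr0.
have : `|f (`|v|^-1 *: v)| <= `|f| by apply: dual_norm_ub; rewrite normfZV.
by rewrite dual_linZ normrM normfV normr_id ler_pdivrMl ?normr_gt0// mulrC.
Qed.

Lemma dual_le_norm f v : `|v| <= 1 -> f v <= `|f|.
Proof. by move=> v1; apply: le_trans (ler_norm _) (dual_norm_ub _ v1). Qed.

(** A one-sided bound suffices, since evaluating at [- v] gives the other side. *)
Lemma dual_of_linear (F : {linear X -> R^o}) (M : R) :
  0 <= M -> (forall v, F v <= M * `|v|) ->
  exists f : dual X, (forall v, f v = F v) /\ `|f| <= M.
Proof.
move=> M0 FM.
have absF v : `|F v| <= M * `|v|.
  by rewrite ler_norml FM andbT lerNl -[- F v](linearN F) -(normrN v) FM.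
have FD : (F : X -> R^o) \in @dual_pred R X.
  apply/asboolP; split; first exact: linearP.
  apply: bounded_linear_continuous; apply/linear_boundedP.
  exists M; split=> [|r /= Mr v]; first exact: num_real.
  by rewrite (le_trans (absF v))// ler_wpM2r// ltW.
exists (Dual FD); split=> //; apply: dual_norm_le => v v1 /=.
by rewrite (le_trans (absF v))// ler_piMr.
Qed.

End dual_theory.

(** * Norm attainment and the basic Bishop-Phelps-Bollobás construction *)

Section finite_dimensional_dual.
Context {R : realType} {X : finDimBanachType R}.
Implicit Types (f g : dual X) (v x : X).

Lemma dual_norm_attained f : exists2 z : X, `|z| <= 1 & f z = `|f|.
Proof.
have B0 : [set x : X | `|x| <= 1] !=set0 by exists 0; rewrite /= normr0.
have cf : continuous (f : X -> R) := @dual_continuous _ _ f.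
have [z] := compact_EVT_max B0 (@compact_closed_ball R X)
  (continuous_subspaceT cf).
rewrite inE/= => z1 zmax; exists z => //; apply/eqP.
rewrite eq_le dual_le_norm//=; apply: dual_norm_le => v v1.
rewrite ler_norml lerNl -dual_linN.
by apply/andP; split; apply: zmax; rewrite inE//= normrN.
Qed.

Lemma sublinear_norm (k : R) : 0 <= k -> sublinear (fun v : X => k * `|v|).
Proof.
move=> k0; split=> [u v|a v a0]; first by rewrite -mulrDr ler_wpM2l// ler_normD.
by rewrite normrZ ger0_norm// mulrCA.
Qed.

Lemma norming_functional x : exists2 f : dual X, `|f| <= 1 & f x = `|x|.
Proof.
have sp := sublinear_norm (@ler01 R).
pose C : set (X * R) :=
  [set c | exists2 t : R, 0 <= t & c = (t *: x, t * `|x|)].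
have CC : convex_cone C by exact: convex_cone_ray.
have Cp c : C c -> c.2 <= 1 * `|c.1|.
  by move=> [t t0 ->] /=; rewrite mul1r normrZ ger0_norm.
have [F [F1 FC]] := hahn_banach sp CC Cp.
have [f [fF f1]] := dual_of_linear ler01 F1.
exists f => //; apply/eqP; rewrite eq_le fF.
have -> : F x <= `|x| by have := F1 x; rewrite mul1r.
by apply: (FC (x, `|x|)); exists 1; rewrite ?scale1r ?mul1r.
Qed.

(** Maximality of [y] gives [f d <= k * |d|] for all directions [d] from [y] into the ball.
    Hahn-Banach then yields [h] of norm at most [k] that dominates [f] on these directions, so
    [f - h] attains its norm at [y]; [g] is [f - h] normalized and [t] is its norm. *)
Lemma BPB_pair x f (k : R) : `|x| <= 1 -> `|f| = 1 -> 0 < k < 1 ->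
  exists y g (t : R), [/\ norming_pairs (y, g), k * `|x - y| <= f y - f x,
    `|f - t *: g| <= k & `|1 - t| <= k].
Proof.
move=> x1 f1 /andP[k0 k1].
pose phi z : R := f z - k * `|z - x|.
have cphi : continuous phi.
  move=> z; apply: cvgB; first exact: dual_continuous.
  apply: cvgM; first exact: cvg_cst.
  by apply: cvg_norm; apply: cvgB => //; exact: cvg_cst.
have B0 : [set x : X | `|x| <= 1] !=set0 by exists x.
have [y] := compact_EVT_max B0 (@compact_closed_ball R X)
  (continuous_subspaceT cphi).
rewrite inE/= => y1 ymax.
have {}ymax z : `|z| <= 1 -> phi z <= phi y.
  by move=> z1; apply: ymax; rewrite inE.
(* The cone over the translated ball [B - y], encoded without division. *)
pose C : set (X * R) :=
  [set c | c.2 = f c.1 /\ exists2 a : R, 0 <= a & `|c.1 + a *: y| <= a].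
have CC : convex_cone C.
  split.
  - split; first by rewrite /= linear0.
    by exists 0 => //=; rewrite scale0r addr0 normr0.
  - move=> [d r] [e s] [/= -> [a a0 da]] [/= -> [b b0 eb]].
    split; first by rewrite linearD.
    exists (a + b); first exact: addr_ge0.
    by rewrite scalerDl addrACA (le_trans (ler_normD _ _))// lerD.
  - move=> a [d r] a0 [/= -> [b b0 db]]; split; first by rewrite linearZ.
    exists (a * b); first by rewrite mulr_ge0// ltW.
    by rewrite -scalerA -scalerDr normrZ gtr0_norm// ler_wpM2l// ltW.
have Cp c : C c -> c.2 <= k * `|c.1|.
  case: c => d s [/= -> [a a0 da]].
  move: a0; rewrite le_eqVlt => /predU1P[a0|a0].
    move: da; rewrite -a0 scale0r addr0 normr_le0 => /eqP ->.
    by rewrite linear0 normr0 mulr0.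
  pose z := a^-1 *: d + y.
  have z1 : `|z| <= 1.
    rewrite -(ler_pM2l a0) mulr1 -[a in a * _]gtr0_norm// -normrZ.
    by rewrite scalerDr scalerA divff ?gt_eqF// scale1r.
  have -> : d = a *: (z - y) by rewrite addrK scalerA divff ?gt_eqF// scale1r.
  rewrite dual_linZ normrZ gtr0_norm// [leRHS]mulrCA ler_wpM2l ?(ltW a0)//.
  have : k * `|z - x| <= k * `|z - y| + k * `|y - x|.
    by rewrite -mulrDr ler_wpM2l ?(ltW k0)// ler_distD.
  have := ymax z z1; rewrite /phi dual_linB => ? ?; lra.
have [F [Fk FC]] := hahn_banach (sublinear_norm (ltW k0)) CC Cp.
have [h [hF hk]] := dual_of_linear (ltW k0) Fk.
pose g1 := f - h.
have g1B z : g1 z = f z - h z :> R by [].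
have g1y z : `|z| <= 1 -> g1 z <= g1 y.
  move=> z1; have : C (z - y, f (z - y)).
    by split=> //; exists 1 => //; rewrite scale1r subrK.
  by rewrite !g1B => /FC /=; rewrite -hF !dual_linB => ?; lra.
have g1E : `|g1| = g1 y.
  apply/eqP; rewrite eq_le dual_le_norm// andbT; apply: dual_norm_le => z z1.
  rewrite ler_norml lerNl -dual_linN.
  by rewrite !g1y// normrN.
have tk : `|1 - `|g1| | <= k.
  rewrite -f1 (le_trans (ler_dist_dist _ _))// /g1 opprB addrC subrK.
  exact: hk.
(* Here [k < 1] prevents [f - h] from vanishing. *)
have t0 : 0 < `|g1| by have := ler_normlP _ _ tk => -[? ?]; lra.
exists y, (`|g1|^-1 *: g1), `|g1|; split=> //.
- have gn : `| `|g1|^-1 *: g1| = 1.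
    by rewrite normrZ normfV normr_id mulVf// gt_eqF.
  have gy : (`|g1|^-1 *: g1) y = 1.
    by rewrite dualZE -g1E mulVf// gt_eqF.
  split=> //=; apply/eqP; rewrite eq_le y1/=.
  have := dual_ler_norm (`|g1|^-1 *: g1) y.
  by rewrite gy gn mul1r normr1.
- have := ymax x x1; rewrite /phi subrr normr0 mulr0 subr0 (distrC y x); lra.
- by rewrite scalerA divff ?gt_eqF// scale1r /g1 opprB addrC subrK.
Qed.

End finite_dimensional_dual.

(** * Squares in the unit ball and copies of the maximum-norm plane *)

Section square.
Context {R : realType}.

(** For [b <= a], write the combination as [a *: (u + v) - (a - b) *: v]; its norm is at least
    [2 * a - (a - b)]. *)
Lemma normD_l1 (V : normedModType R) (u v : V) (a b : R) :
  `|u| <= 1 -> `|v| <= 1 -> `|u + v| = 2 -> 0 <= a -> 0 <= b ->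
  `|a *: u + b *: v| = a + b.
Proof.
move=> u1 v1 uv.
wlog ba : u v a b u1 v1 uv / b <= a => [wl|] a0 b0.
  have [|/ltW] := leP b a; first by move=> ?; exact: wl.
  by move=> ?; rewrite addrC [RHS]addrC; apply: wl => //; rewrite addrC.
apply/eqP; rewrite eq_le; apply/andP; split.
  rewrite (le_trans (ler_normD _ _))// !normrZ !ger0_norm//.
  by rewrite lerD// ler_piMr.
have -> : a *: u + b *: v = a *: (u + v) - (a - b) *: v.
  by rewrite scalerBl scalerDr opprB addrCA -addrA subrr addr0 addrC.
apply: le_trans (lerB_dist _ _); rewrite !normrZ uv !ger0_norm ?subr_ge0//.
have : (a - b) * `|v| <= a - b by rewrite ler_piMr// subr_ge0.
by move=> ?; lra.
Qed.

Lemma linfty2_of_square (V : normedModType R) (u v : V) :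
  `|u| <= 1 -> `|v| <= 1 -> `|u + v| = 2 -> `|u - v| = 2 ->
  contains_isometric_copy V (linfty2 R).
Proof.
move=> u1 v1 uDv uBv.
have l1 a b : `|a *: u + b *: v| = `|a| + `|b| :> R.
  have vN1 : `|- v| <= 1 by rewrite normrN.
  have PD c d : 0 <= c -> 0 <= d -> `|c *: u + d *: v| = c + d.
    exact: normD_l1.
  have PB c d : 0 <= c -> 0 <= d -> `|c *: u - d *: v| = c + d.
    by rewrite -scalerN; exact: normD_l1.
  have [a0|/ltW a0] := leP 0 a; have [b0|/ltW b0] := leP 0 b.
  - by rewrite PD// !ger0_norm.
  - by rewrite (ger0_norm a0) (ler0_norm b0) -PB ?oppr_ge0// scaleNr opprK.
  - rewrite (ler0_norm a0) (ger0_norm b0) -PB ?oppr_ge0// scaleNr -opprD.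
    by rewrite normrN.
  - rewrite (ler0_norm a0) (ler0_norm b0) -PD ?oppr_ge0// !scaleNr -opprD.
    by rewrite normrN.
(* The numbers [|a + b| / 2] and [|a - b| / 2] add up to the maximum of [|a|] and [|b|], so this
   change of coordinates carries the maximum norm to the [l_1] norm. *)
pose T (y : linfty2 R) : V :=
  ((y 0 0 + y 0 1) / 2) *: u + ((y 0 0 - y 0 1) / 2) *: v.
have Tl : linear T.
  move=> a x y; rewrite /T !mxE scalerDr !scalerA [RHS]addrACA -!scalerDl.
  by congr (_ *: _ + _ *: _); ring.
pose F : {linear linfty2 R -> V} :=
  HB.pack T (GRing.isLinear.Build R (linfty2 R) V *:%R T Tl).
exists F => y; rewrite [LHS]l1 linfty2_normE.
set a := y 0 0; set b := y 0 1.
have max_eq (c : R) : `|a| <= c -> `|b| <= c -> c <= `|a| \/ c <= `|b| ->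
    c = Num.max `|a| `|b|.
  move=> ac bc cab; apply/eqP; rewrite eq_le le_max ge_max ac bc andbT.
  by case: cab => ->; rewrite ?orbT.
have := ler_norm ((a + b) / 2); have := ler_norm ((a - b) / 2).
have := ler_norm (- ((a + b) / 2)); have := ler_norm (- ((a - b) / 2)).
rewrite !normrN => ? ? ? ?.
apply: max_eq; [by rewrite ler_norml; apply/andP; split; lra..|].
have := ler_norm a; have := ler_norm b.
have := ler_norm (- a); have := ler_norm (- b); rewrite !normrN.
have [?|?] := ger0P ((a + b) / 2); have [?|?] := ger0P ((a - b) / 2);
  by move=> ? ? ? ?; (left; lra) || (right; lra).
Qed.

(** Norming functionals [f] of [u + v] and [g] of [u - v] take the values [1, 1] and [1, -1] at
    [u, v]. Thus [f + g] equals 2 at [u] and [f - g] equals 2 at [v], a square in the dual. *)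
Lemma linfty2_of_square_dual (X : finDimBanachType R) (u v : X) :
  `|u| <= 1 -> `|v| <= 1 -> `|u + v| = 2 -> `|u - v| = 2 ->
  contains_isometric_copy (dual X) (linfty2 R).
Proof.
move=> u1 v1 uDv uBv.
have [f f1 fuv] := norming_functional (u + v).
have [g g1 guv] := norming_functional (u - v).
have le1 (h : dual X) (x : X) : `|h| <= 1 -> `|x| <= 1 -> -1 <= h x <= 1.
  move=> h1 x1; rewrite -ler_norml (le_trans (dual_ler_norm _ _))//.
  by rewrite mulr_ile1.
have /andP[fu fu'] := le1 f u f1 u1; have /andP[fv fv'] := le1 f v f1 v1.
have /andP[gu gu'] := le1 g u g1 u1; have /andP[gv gv'] := le1 g v g1 v1.
move: fuv guv; rewrite uDv uBv dual_linD dual_linB => fuv guv.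
apply: (@linfty2_of_square _ f g) => //.
- apply/eqP; rewrite eq_le; apply/andP; split.
    by rewrite (le_trans (ler_normD _ _))// lerD.
  by apply: le_trans (dual_le_norm (f + g) u1); rewrite dualDE; lra.
- apply/eqP; rewrite eq_le; apply/andP; split.
    by rewrite (le_trans (ler_normB _ _))// lerD.
  by apply: le_trans (dual_le_norm (f - g) v1); rewrite dualBE; lra.
Qed.

Lemma square_of_almost_squares (X : finDimBanachType R) :
  (forall e : R, 0 < e -> exists u v : X,
     [/\ `|u| <= 1, `|v| <= 1, 2 - e <= `|u + v| & 2 - e <= `|u - v|]) ->
  exists u v : X, [/\ `|u| <= 1, `|v| <= 1, `|u + v| = 2 & `|u - v| = 2].
Proof.
move=> almost.
pose B := [set x : X | `|x| <= 1].
have cB := @compact_closed_ball R X.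
(* A single continuous function controls both diagonals; its maximum over the compact product of
   balls is at least [2 - e] for every [e]. *)
pose F (p : X * X) : R := Num.min `|p.1 + p.2| `|p.1 - p.2|.
have cF : continuous F.
  move=> p; apply: (continuous_min (f := fun p : X * X => `|p.1 + p.2|)
    (g := fun p : X * X => `|p.1 - p.2|)).
    by apply: cvg_norm; apply: cvgD; [exact: cvg_fst|exact: cvg_snd].
  by apply: cvg_norm; apply: cvgB; [exact: cvg_fst|exact: cvg_snd].
have BB0 : B `*` B !=set0 by exists (0, 0); split; rewrite /B/= normr0.
have [[u v]] := compact_EVT_max BB0 (compact_setX cB cB)
  (continuous_subspaceT cF).
rewrite inE => -[/= u1 v1] uvmax.
have F2 : 2 <= F (u, v).
  apply/ler_addgt0Pr => e e0; rewrite -lerBlDr.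
  have [u' [v' [u'1 v'1 uD uB]]] := almost e e0.
  apply: le_trans (uvmax (u', v') _); last by rewrite inE.
  by rewrite le_min uD uB.
move: F2; rewrite le_min/= => /andP[uD uB].
exists u, v; split=> //; apply/eqP; rewrite eq_le ?uD ?uB andbT.
- by rewrite (le_trans (ler_normD _ _))// lerD.
- by rewrite (le_trans (ler_normB _ _))// lerD.
Qed.

End square.

(** * Almost squares and the numerical estimates *)

Section approximation.
Context {R : realType} {X : finDimBanachType R}.
Implicit Types (f g : dual X) (x : X).

(* In [almost_square], a = h z, b = g z, a' = h z' and b' = g z', where
   f = h + t g, the functional f - g attains its norm at z, and f at z'. *)
Lemma almost_square_bounds (k e t a b a' b' : R) : 0 < k < 1 -> e < 1 ->
  2 * k < k * e + e -> - k <= 1 - t <= k -> a <= k -> -1 <= b ->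
  e <= a + t * b - b -> a + t * b <= 1 -> a' <= k -> b' <= 1 ->
  1 = a' + t * b' ->
  [/\ e - k <= a, e - k <= k * - b, e - k <= a' & e - k <= k * b'].
Proof.
move=> /andP[k0 k1] e1 ke /andP[tk tk'] ak b1 eab ab1 a'k b'1 ab'.
have ke' : k * e < k by rewrite gtr_pMr.
have ek : k < e by lra.
have t0 : 0 < t by lra.
have t1 : t <= 1.
  (* If [t > 1], then [0 < b <= 1 - e] and [e - k <= (t - 1) * b <= k * (1 - e)], against
     [2 * k < k * e + e]. *)
  rewrite leNgt; apply/negP => t1.
  have gz0 : e - k <= (t - 1) * b by lra.
  have gzp : 0 < b by rewrite -(pmulr_rgt0 _ (_ : 0 < t - 1)); lra.
  have : (t - 1) * b <= k * b by rewrite ler_wpM2r ?(ltW gzp)//; lra.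
  have : k * b <= k * (1 - e) by rewrite ler_wpM2l ?(ltW k0)//; lra.
  by move=> ? ?; lra.
have gz0 : e - k <= (1 - t) * - b by lra.
have gzn : b <= 0.
  rewrite leNgt; apply/negP => gzp.
  have : 0 <= (1 - t) * b by rewrite mulr_ge0 ?(ltW gzp)//; lra.
  by move=> ?; lra.
have tgz : (1 - t) * - b <= k * - b by rewrite ler_wpM2r; lra.
have kgz : k * - b <= k * 1 by rewrite ler_wpM2l ?(ltW k0)//; lra.
have hzk : e - k <= a by lra.
have gzk : e - k <= k * - b by lra.
have tek : e - k <= 1 - t.
  have : (1 - t) * - b <= (1 - t) * 1 by rewrite ler_wpM2l; lra.
  by move=> ?; lra.
have hz'k : e - k <= a'.
  have : t * b' <= t * 1 by rewrite ler_wpM2l ?(ltW t0).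
  by move=> ?; lra.
have gz'k : e - k <= k * b'.
  (* After multiplication by [t], the gap [k * (1 - k) - (1 - (e - k)) * (e - k)] factors as
     [(2 * k - e) * (1 - e)], which is nonnegative because [e <= 2 * k]. *)
  rewrite -(ler_pM2l t0).
  have : t * (e - k) <= (1 - (e - k)) * (e - k) by rewrite ler_wpM2r; lra.
  have : k * (1 - k) <= k * (t * b') by rewrite ler_wpM2l ?(ltW k0)//; lra.
  have : 0 <= (2 * k - e) * (1 - e) by apply: mulr_ge0; lra.
  by move=> ? ? ?; lra.
by split.
Qed.

(** The bound on [f x] forces [|x - y| < e] in [BPB_pair], hence [|f - g| >= e]. At [z] norming
    [f - g] and [z'] norming [f], [h = f - t g] is at least [e - k], while [k * g] is at least
    [e - k] at [z'] and at most [k - e] at [z]. *)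
Lemma almost_square x f (k e : R) : `|x| = 1 -> `|f| = 1 ->
  0 < k < 1 -> 0 < e < 1 -> 2 * k < k * e + e -> 1 - k * e < f x ->
  (forall q, norming_pairs q -> `|x - q.1| < e -> e <= `|f - q.2|) ->
  exists u v : X, [/\ `|u| <= 1, `|v| <= 1,
    2 * (e - k) <= k * `|u + v| & 2 * (e - k) <= k * `|u - v|].
Proof.
move=> x1 f1 k01 /andP[e0 e1] ke fx far.
have x1' : `|x| <= 1 by rewrite x1.
have [y [g [t [yg xy ftg tk]]]] := BPB_pair x1' f1 k01.
have /andP[k0 k1] := k01.
have [/= y1 g1 gy] := yg.
have fy1 : f y <= 1 by rewrite -f1 dual_le_norm// y1.
have fg : e <= `|f - g|.
  by apply: (far _ yg); rewrite /= -(ltr_pM2l k0) (le_lt_trans xy)//; lra.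
have [z z1 fgz] := dual_norm_attained (f - g).
have [z' z'1 fz'] := dual_norm_attained f.
rewrite -fgz dualBE in fg; rewrite f1 in fz'.
pose h w : R := f w - t * g w.
have hk w : `|w| <= 1 -> - k <= h w <= k.
  move=> w1; rewrite -ler_norml -[h w]/((f - t *: g) w : R).
  rewrite (le_trans (dual_ler_norm _ _))// (le_trans _ ftg)//.
  by rewrite ler_piMr.
have gb w : `|w| <= 1 -> -1 <= g w <= 1.
  by move=> w1; rewrite -ler_norml (le_trans (dual_ler_norm _ _))// g1 mul1r.
have fz1 : f z <= 1 by rewrite -f1 dual_le_norm.
rewrite ler_norml in tk.
have /andP[hz hz'] := hk z z1; have /andP[gz gz'] := gb z z1.
have /andP[hz'' hz'''] := hk z' z'1; have /andP[gz'' gz'''] := gb z' z'1.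
have fz1' : h z + t * g z <= 1 by rewrite /h subrK.
have fz'E : 1 = h z' + t * g z' by rewrite /h subrK.
have fgz' : e <= h z + t * g z - g z by rewrite /h subrK.
have [hzk gzk hz'k gz'k] := almost_square_bounds k01 e1 ke tk hz' gz fgz' fz1'
  hz''' gz''' fz'E.
exists z', z; split=> //.
  have : h (z' + z) <= k * `|z' + z|.
    apply: le_trans (ler_norm _) _.
    rewrite -[h _]/((f - t *: g) (z' + z) : R).
    by rewrite (le_trans (dual_ler_norm _ _))// ler_wpM2r.
  by rewrite /h !dual_linD; move: hzk hz'k; rewrite /h => ? ? ?; lra.
have : k * g (z' - z) <= k * `|z' - z|.
  rewrite ler_wpM2l ?(ltW k0)// (le_trans (ler_norm _))//.
  by rewrite (le_trans (dual_ler_norm _ _))// g1 mul1r.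
by rewrite dual_linB => ?; lra.
Qed.

(** Here [r] and [s] stand for the defects [1 - |x|] and [1 - |f|], and [M] for the target distance.
    The last hypothesis lets the defects pay for taking [M] below [w]. *)
Lemma BPB_ball_inequality (w d M r s : R) : 0 < d < 1 / 2 -> 0 < w ->
  w ^+ 2 = 2 * d -> M <= w -> 0 <= r <= 1 -> 0 <= s <= 1 ->
  1 - d < (1 - r) * (1 - s) ->
  2 * w * (w - M) <= (7 / 4 - 3 / 2 * d - w) * (r + s) ->
  (1 - r) * (1 - s) * (1 - (M - r) * (M - s) / 2) <= 1 - d.
Proof.
move=> /andP[d0 d1] w0 w2 M2 /andP[r0 r1] /andP[s0 s1] rs wM.
have r12 : r <= 1 / 2.
  have : (1 - r) * (1 - s) <= 1 - r by rewrite ler_piMr; lra.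
  by move=> ?; lra.
have s12 : s <= 1 / 2.
  have : (1 - r) * (1 - s) <= 1 - s by rewrite ler_piMl; lra.
  by move=> ?; lra.
have b4 : r * s <= (r + s) / 4.
  have : r * s <= r * (1 / 2) by rewrite ler_wpM2l.
  have : r * s <= (1 / 2) * s by rewrite ler_wpM2r.
  by move=> ? ?; lra.
have b0 : 0 <= r * s by rewrite mulr_ge0.
(* The constants make [(r + s - r * s) * (1 - d) - Q] equal to
   [(1 / 2 - d) * ((r + s) / 4 - r * s)], with [Q] as below, while [7 / 4 - 3 / 2 * d - w] stays
   positive for [d < 1 / 2] and [w < 1]. *)
pose P := 2 * d + r * s - (r + s) * (7 / 4 - 3 / 2 * d).
have PM : P <= (M - r) * (M - s).
  have : 0 <= (w - M) * (w - M + (r + s)) by apply: mulr_ge0; lra.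
  by move: w2 wM; rewrite /P expr2 => ? ? ?; lra.
have q0 : 0 <= (1 - r) * (1 - s) by apply: mulr_ge0; lra.
have q1 : (1 - r) * (1 - s) <= 1 by apply: mulr_ile1; lra.
apply: (@le_trans _ _ ((1 - r) * (1 - s) * (1 - P / 2))).
  by rewrite ler_wpM2l//; lra.
have [Q QE] : exists Q, Q = (r + s) * (7 / 8 - 3 / 4 * d) - r * s / 2.
  by eexists.
have K : Q <= (r + s - r * s) * (1 - d).
  have : 0 <= (1 / 2 - d) * ((r + s) / 4 - r * s) by apply: mulr_ge0; lra.
  by rewrite QE => ?; lra.
have K0 : 0 <= Q.
  have : 0 <= (r + s) * (3 / 8 - 3 / 4 * d) by apply: mulr_ge0; lra.
  by rewrite QE => ?; lra.
have -> : 1 - P / 2 = 1 - d + Q by rewrite /P QE; lra.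
have : (1 - r) * (1 - s) * Q <= Q by rewrite ler_piMl.
by move=> ?; lra.
Qed.

End approximation.

(** * Comparison of the two moduli and the extremal case *)

Section moduli.
Context {R : realType} {X : finDimBanachType R}.
Implicit Types (f : dual X) (x : X).

Lemma norm_sub_normalize (V : normedModType R) (v : V) :
  v != 0 -> `|v| <= 1 -> `|v - `|v|^-1 *: v| = 1 - `|v|.
Proof.
move=> v0 v1; have nv : 0 < `|v| by rewrite normr_gt0.
rewrite -{1}[v]scale1r -scalerBl normrZ distrC ger0_norm; last first.
  by rewrite subr_ge0 -invr1 lef_pV2 ?posrE.
by rewrite mulrBl mul1r mulVf ?gt_eqF.
Qed.

Lemma normalize_pair x f (d : R) : d < 1 -> `|x| <= 1 -> `|f| <= 1 ->
  1 - d < f x ->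
  [/\ x != 0, f != 0, 1 - d < `|x| * `|f| &
      (`|f|^-1 *: f) (`|x|^-1 *: x) = f x / (`|x| * `|f|)].
Proof.
move=> d1 x1 f1 fx.
have xf : 1 - d < `|x| * `|f|.
  rewrite (lt_le_trans fx)// (le_trans (ler_norm _))// mulrC.
  exact: dual_ler_norm.
split=> //.
- by apply: contraTneq xf => ->; rewrite normr0 mul0r -leNgt; lra.
- by apply: contraTneq xf => ->; rewrite normr0 mulr0 -leNgt; lra.
- by rewrite dualZE dual_linZ invfM mulrA mulrC [X in _ * X = _]mulrC.
Qed.

(** Normalize both components, then apply [BPB_pair]; [BPB_ball_inequality] controls the
    displacement of the point. *)
Lemma BPB_ball x f (w d M : R) : 0 < d < 1 / 2 -> 0 < w < 1 ->
  w ^+ 2 = 2 * d -> w / 2 <= M <= w -> `|x| <= 1 -> `|f| <= 1 ->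
  1 - d < f x ->
  2 * w * (w - M) <= (7 / 4 - 3 / 2 * d - w) * ((1 - `|x|) + (1 - `|f|)) ->
  exists2 q, norming_pairs q & `|x - q.1| <= M /\ `|f - q.2| <= M.
Proof.
move=> d012 /andP[w0 w1] w2 /andP[M0 M1] x1 f1 fx wM.
have /andP[d0 d12] := d012.
have d1 : d < 1 by lra.
have [x0 f0 xf fxE] := normalize_pair d1 x1 f1 fx.
have nx : 0 < `|x| by rewrite normr_gt0.
have nf : 0 < `|f| by rewrite normr_gt0.
have dw : d < w / 2.
  have : w * w < w * 1 by rewrite ltr_pM2l.
  by move: w2; rewrite expr2 => ? ?; lra.
have xfx : `|x| * `|f| <= `|x| by rewrite ler_piMr// ltW.
have xff : `|x| * `|f| <= `|f| by rewrite ler_piMl// ltW.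
(* Chosen so that normalizing [f] and then moving by [2 * k] costs exactly [M]; it is positive since
   [1 - |f| < d < w / 2 <= M]. *)
pose k := (M - (1 - `|f|)) / 2.
have k01 : 0 < k < 1 by rewrite /k; apply/andP; split; lra.
have x'1 : `| `|x|^-1 *: x| <= 1 by rewrite normfZV.
have f'1 : `| `|f|^-1 *: f| = 1 by exact: normfZV.
have [y [g [t [yg xy ftg tk]]]] := BPB_pair x'1 f'1 k01.
have [/= y1 g1 gy] := yg.
have f'y : (`|f|^-1 *: f) y <= 1 by rewrite -f'1 dual_le_norm// y1.
have k0 : 0 < k by case/andP: k01.
exists (y, g) => //=; split.
  have : `|x - y| <= (1 - `|x|) + `| `|x|^-1 *: x - y|.
    by rewrite -(norm_sub_normalize x0 x1) ler_distD.
  suff : `| `|x|^-1 *: x - y| <= M - (1 - `|x|) by move=> ? ?; lra.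
  rewrite -(ler_pM2l k0) (le_trans xy)//.
  apply: (@le_trans _ _ (1 - f x / (`|x| * `|f|))); first by rewrite fxE lerB.
  have s01 : 0 <= 1 - `|f| <= 1 by apply/andP; split; lra.
  have r01 : 0 <= 1 - `|x| <= 1 by apply/andP; split; lra.
  have e v : 1 - (1 - v) = v :> R by lra.
  have := BPB_ball_inequality d012 w0 w2 M1 r01 s01.
  rewrite !e => /(_ xf wM) H.
  have : 1 - (M - (1 - `|x|)) * (M - (1 - `|f|)) / 2 <= f x / (`|x| * `|f|).
    rewrite ler_pdivlMr ?mulr_gt0// mulrC (le_trans H)// ltW//.
  by rewrite /k => ?; lra.
have : `|f - g| <= (1 - `|f|) + (k + k).
  rewrite -(norm_sub_normalize f0 f1).
  rewrite (le_trans (ler_distD (`|f|^-1 *: f) _ _))//.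
  rewrite lerD2l (le_trans (ler_distD (t *: g) _ _))// lerD//.
  by rewrite -{2}[g]scale1r -scalerBl normrZ g1 mulr1 distrC.
by rewrite /k => ?; lra.
Qed.

(** With every value above [w] already in [A], only an element below [w] can change the infimum. *)
Lemma inf_eqP (A : set R) (w : R) : (forall e, w < e -> A e) ->
  has_lbound A -> inf A = w <-> forall e, e < w -> ~ A e.
Proof.
move=> Aw lA; split=> [<- e ew /(ge_inf lA)|Awn]; first by rewrite leNgt ew.
apply/eqP; rewrite eq_le; apply/andP; split.
  apply/ler_addgt0Pr => e e0; apply: ge_inf => //; apply: Aw; lra.
apply: lb_le_inf; first by exists (w + 1); apply: Aw; lra.
by move=> e Ae; rewrite leNgt; apply/negP => /Awn.
Qed.

Lemma BPB_admissible_lbound (D : set (X * dual X)) (d : R) :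
  has_lbound (BPB_admissible D d).
Proof. by exists 0 => e [/ltW]. Qed.

Lemma BPB_admissible_subset (D D' : set (X * dual X)) (d : R) :
  D `<=` D' -> BPB_admissible D' d `<=` BPB_admissible D d.
Proof. by move=> DD' e [e0 eD]; split=> // p /DD'; exact: eD. Qed.

Lemma sphere_sub_ball_pairs : @sphere_pairs R X `<=` @ball_pairs R X.
Proof. by move=> p [p1 p2]; split; rewrite ?p1 ?p2. Qed.

Lemma BPB_ball_gt (d w e : R) : 0 < d < 1 / 2 -> 0 < w < 1 ->
  w ^+ 2 = 2 * d -> w < e -> BPB_admissible (@ball_pairs R X) d e.
Proof.
move=> d012 w01 w2 we; have /andP[d0 d1] := d012; have /andP[w0 w1] := w01.
split=> [|[x f] [/= x1 f1] fx]; first by lra.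
have [||q qN [xq fq]] := @BPB_ball x f w d w d012 w01 w2 _ x1 f1 fx.
- by apply/andP; split; lra.
- by rewrite subrr mulr0; apply: mulr_ge0; lra.
- by exists q => //; split; lra.
Qed.

(* Pairs close to the product of the spheres are handled by normalization; for
   the others the estimate of [BPB_ball] has room to spare. *)
Lemma BPB_ball_of_sphere (d w e : R) : 0 < d < 1 / 2 -> 0 < w < 1 ->
  w ^+ 2 = 2 * d -> e < w -> BPB_admissible (@sphere_pairs R X) d e ->
  exists2 e', e' < w & BPB_admissible (@ball_pairs R X) d e'.
Proof.
move=> d012 w01 w2 ew [e0 eS]; have /andP[d0 d12] := d012.
have /andP[w0 w1] := w01.
pose c := 7 / 4 - 3 / 2 * d - w.
have c0 : 0 < c by rewrite /c; lra.
pose n := (w - e) / 2.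
have n0 : 0 < n by rewrite /n; lra.
(* The second term gives [2 * w * m <= c * n], so total defect at least [n] permits [M = w - m]; the
   first keeps [M >= w / 2]. *)
pose m := Num.min (w / 2) (c * n / (2 * w)).
have w20 : 0 < 2 * w by rewrite mulr_gt0.
have m0 : 0 < m by rewrite lt_min !divr_gt0// mulr_gt0.
have mw : m <= w / 2 by rewrite ge_min lexx.
have mc : 2 * w * m <= c * n.
  by rewrite mulrC -ler_pdivlMr// ge_min lexx orbT.
(* The near case costs [e] plus a defect below [n]; the far case costs at most [w - m], and [m / 2]
   makes this strict. *)
exists (Num.max (e + n) (w - m / 2)).
  by rewrite gt_max; apply/andP; split; rewrite /n; lra.
split=> [|[x f] [/= x1 f1] fx]; first by rewrite lt_max; apply/orP; left; lra.
have d1 : d < 1 by lra.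
have [x0 f0 xf fxE] := normalize_pair d1 x1 f1 fx.
have [far|near] := leP n ((1 - `|x|) + (1 - `|f|)).
  have [||q qN [xq fq]] := @BPB_ball x f w d (w - m) d012 w01 w2 _ x1 f1 fx.
  - by apply/andP; split; lra.
  - by rewrite opprB addrCA subrr addr0 (le_trans mc)// ler_wpM2l// ltW.
  - exists q => //; split; rewrite lt_max; apply/orP; right; lra.
have [||q qN [/= xq fq]] := eS (`|x|^-1 *: x, `|f|^-1 *: f).
- by split; exact: normfZV.
- apply: (@lt_le_trans _ _ (f x / (`|x| * `|f|))); last by rewrite -fxE.
  rewrite (lt_le_trans fx)// ler_pdivlMr ?mulr_gt0 ?normr_gt0//.
  by rewrite ler_piMr ?mulr_ile1//; lra.
exists q => //=; split; rewrite lt_max; apply/orP; left.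
  have := ler_distD (`|x|^-1 *: x) x q.1.
  by rewrite norm_sub_normalize// => ?; lra.
have := ler_distD (`|f|^-1 *: f) f q.2.
by rewrite norm_sub_normalize// => ?; lra.
Qed.

Lemma square_of_sphere_modulus (d w : R) : 0 < w < 1 -> w ^+ 2 = 2 * d ->
  (forall e, e < w -> ~ BPB_admissible (@sphere_pairs R X) d e) ->
  exists u v : X, [/\ `|u| <= 1, `|v| <= 1, `|u + v| = 2 & `|u - v| = 2].
Proof.
move=> /andP[w0 w1] w2 eS; apply: square_of_almost_squares => a a0.
(* With [e = w (1 - s)] and [k = d / e] one has
   [2 (e - k) / k = 4 (1 - s)^2 - 2 >= 2 - 8 s]. *)
pose s := Num.min (a / 8) (w / 16).
have s0 : 0 < s by rewrite lt_min !divr_gt0.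
have sa : s <= a / 8 by rewrite ge_min lexx.
have sw : s <= w / 16 by rewrite ge_min lexx orbT.
have s1 : 0 < 1 - s by lra.
pose e := w * (1 - s).
pose k := w / (2 * (1 - s)).
have e0 : 0 < e by rewrite mulr_gt0.
have ew : e < w by rewrite gtr_pMr//; lra.
have k0 : 0 < k by rewrite divr_gt0// mulr_gt0.
have kE : k * (2 * (1 - s)) = w by rewrite mulfVK// gt_eqF// mulr_gt0.
have ss : 0 <= s * s by rewrite mulr_ge0// ltW.
have eE : e = k * (2 * (1 - s) ^+ 2) by rewrite /e -{1}kE; ring.
have dke : d = k * e.
  have : k * e * 2 = w * w by rewrite /e -{2}kE; ring.
  by move: w2; rewrite expr2 => ? ?; lra.
have [x [f [x1 f1 fx far]]] : exists x f, [/\ `|x| = 1, `|f| = 1, 1 - d < f x &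
    forall q, norming_pairs q -> `|x - q.1| < e -> e <= `|f - q.2|].
  apply: contra_notP (eS e ew) => H; split=> // -[x f] [/= x1 f1] fx.
  apply: contrapT => qH; apply: H; exists x, f; split=> // q qN xq.
  by rewrite leNgt; apply/negP => fq; apply: qH; exists q.
have k1 : 0 < k < 1.
  rewrite k0 /k ltr_pdivrMr ?mulr_gt0//; lra.
have e1 : 0 < e < 1 by rewrite e0/=; lra.
(* Up to the factor [k], the difference is [w - w * s - 4 * s + 2 * s ^+ 2], positive because
   [s <= w / 16]. *)
have ke : 2 * k < k * e + e.
  rewrite -subr_gt0; have -> : k * e + e - 2 * k =
      k * (w * (1 - s) + 2 * (1 - s) ^+ 2 - 2).
    by rewrite {2}eE /e; ring.
  rewrite mulr_gt0//; have : w * s <= w * (1 / 2).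
    by rewrite ler_wpM2l ?(ltW w0)//; lra.
  by rewrite expr2 => ?; lra.
rewrite dke in fx.
have [u [v [u1 v1 uv uv']]] := almost_square x1 f1 k1 e1 ke fx far.
have ka : k * (2 - a) <= 2 * (e - k).
  rewrite -subr_ge0; have -> : 2 * (e - k) - k * (2 - a) =
      k * (4 * (1 - s) ^+ 2 - 4 + a).
    by rewrite eE; ring.
  by rewrite mulr_ge0 ?(ltW k0)// expr2; lra.
exists u, v; split=> //; rewrite -(ler_pM2l k0) (le_trans ka)//.
Qed.

End moduli.

(** * Equivalence of the two extremal conditions and the isometric copies *)

Theorem theorem5p8 (R : realType) (X : finDimBanachType R)
    (X_neq0 : exists x : X, x != 0) :
  (forall delta : R, 0 < delta < 1 / 2 ->
     (BPB_modulus X delta = Num.sqrt (2 * delta) <->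
      spherical_BPB_modulus X delta = Num.sqrt (2 * delta))) /\
  ((exists2 delta : R, 0 < delta < 1 / 2 &
      BPB_modulus X delta = Num.sqrt (2 * delta)) ->
   contains_isometric_copy (dual X) (linfty2 R) /\
   contains_isometric_copy X (linfty2 R)).
Proof.
have sqrtP (d : R) : 0 < d < 1 / 2 ->
    0 < Num.sqrt (2 * d) < 1 /\ Num.sqrt (2 * d) ^+ 2 = 2 * d.
  move=> /andP[d0 d1]; rewrite sqr_sqrtr ?mulr_ge0 ?(ltW d0)//; split=> //.
  rewrite sqrtr_gt0 mulr_gt0//= -[ltRHS]sqrtr1 ltr_sqrt//; lra.
have ballP (d : R) : 0 < d < 1 / 2 -> BPB_modulus X d = Num.sqrt (2 * d) <->
    forall e, e < Num.sqrt (2 * d) -> ~ BPB_admissible (@ball_pairs R X) d e.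
  move=> d01; have [w01 w2] := sqrtP d d01; apply: inf_eqP.
    by move=> e; exact: BPB_ball_gt.
  exact: BPB_admissible_lbound.
have sub (d : R) : BPB_admissible (@ball_pairs R X) d `<=`
    BPB_admissible (@sphere_pairs R X) d.
  by apply: BPB_admissible_subset; exact: sphere_sub_ball_pairs.
have sphereP (d : R) : 0 < d < 1 / 2 ->
    spherical_BPB_modulus X d = Num.sqrt (2 * d) <->
    forall e, e < Num.sqrt (2 * d) -> ~ BPB_admissible (@sphere_pairs R X) d e.
  move=> d01; have [w01 w2] := sqrtP d d01; apply: inf_eqP.
    by move=> e we; apply: sub; exact: BPB_ball_gt we.
  exact: BPB_admissible_lbound.
have equiv (d : R) : 0 < d < 1 / 2 ->
    BPB_modulus X d = Num.sqrt (2 * d) <->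
    spherical_BPB_modulus X d = Num.sqrt (2 * d).
  move=> d01; have [w01 w2] := sqrtP d d01.
  rewrite ballP// sphereP//; split=> H e ew eA.
    by have [e' e'w e'A] := BPB_ball_of_sphere d01 w01 w2 ew eA; exact: H e'A.
  by apply: H ew _; exact: sub.
split=> // -[d d01 /equiv-/(_ d01)/sphereP-/(_ d01) dS].
have [w01 w2] := sqrtP d d01.
have [u [v [u1 v1 uDv uBv]]] := square_of_sphere_modulus w01 w2 dS.
split; first exact: linfty2_of_square_dual uDv uBv.
exact: linfty2_of_square uDv uBv.
Qed.
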